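(* Let $f(a,b,c;z)={}_2F_1(a,b;c;z)$, $g=f^2$, $\theta=z\,\frac{d}{dz}$. Work away from the rank-drop locus. (a) In the square basis $B_{\mathrm{sym}}=(f^2,f\theta f,(\theta f)^2)$, $\theta$ acts by $$M_{\theta,\mathrm{sym}}=\begin{pmatrix}0&\dfrac{abz}{1-z}&0\\[2mm]2&\dfrac{(a+b)z-c+1}{1-z}&\dfrac{2abz}{1-z}\\[2mm]0&1&\dfrac{2((a+b)z-c+1)}{1-z}\end{pmatrix}.$$ (b) In the basis $B_g=(g,\theta g,\theta^2g)$, the differential component is the companion matrix $$M_\theta^{(g)}=\begin{pmatrix}0&0&\dfrac{2abz(2c-1-2(a+b)z)}{(1-z)^2}\\[2mm]1&0&\dfrac{-2(a^2+4ab+b^2)z^2+(4ab+4ac+4bc-3a-3b-c+1)z-2(c-1)^2}{(1-z)^2}\\[2mm]0&1&\dfrac{3((a+b)z-c+1)}{1-z}\end{pmatrix}.$$ Equivalently, $g$ is annihilated by $$\mathcal L_{a,b,c}=2\theta(\theta+c-1)(\theta+2c-2)-z\,Q_{a,b,c}(\theta)+2z^2(\theta+a+b)(\theta+2a)(\theta+2b),$$ where $$Q_{a,b,c}(T)=4T^3+6(a+b+c-1)T^2+2(4ab+4ac+4bc-3a-3b-c+1)T+4ab(2c-1).$$ (c) If $g(z)=\sum_{n\ge0}g_nz^n$, then for $n\ge2$ $$2n(n+c-1)(n+2c-2)\,g_n-Q_{a,b,c}(n-1)\,g_{n-1}+2(n+a+b-2)(n+2a-2)(n+2b-2)\,g_{n-2}=0.$$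 (d) In the case $(a,b,c)=(\tfrac12,\tfrac12,1)$, the matrix $\Phi$ with $B_{\mathrm{sym}}\Phi=B_g$ is $$\Phi_\pi(z)=\begin{pmatrix}1&0&\dfrac{z}{2(1-z)}\\[2mm]0&2&\dfrac{2z}{1-z}\\[2mm]0&0&2\end{pmatrix},$$ and $$M_{\theta,\mathrm{sym}}^{(\pi)}=\begin{pmatrix}0&\dfrac{z}{4(1-z)}&0\\[2mm]2&\dfrac{z}{1-z}&\dfrac{z}{2(1-z)}\\[2mm]0&1&\dfrac{2z}{1-z}\end{pmatrix},\qquad M_\theta^{(\pi,\mathrm{sq})}=\begin{pmatrix}0&0&\dfrac{z(1-2z)}{2(1-z)^2}\\[2mm]1&0&\dfrac{z(2-3z)}{(1-z)^2}\\[2mm]0&1&\dfrac{3z}{1-z}\end{pmatrix}.$$ Therefore $g(z)={}_2F_1(\tfrac12,\tfrac12;1;z)^2$ satisfies $$2\theta^3g-z(2\theta+1)(2\theta^2+2\theta+1)g+2z^2(\theta+1)^3g=0,$$ equivalently $$2\theta^3g-(2\theta-1)(2\theta^2-2\theta+1)z\,g+2(\theta-1)^3z^2g=0.$$ If $g(z)=\sum_{n\ge0}g_nz^n$, then $$2n^3g_n-(2n-1)(2n^2-2n+1)g_{n-1}+2(n-1)^3g_{n-2}=0.$$ Finally, if $A_n:=16^ng_n$, then $$n^3A_n=8(2n-1)(2n^2-2n+1)A_{n-1}-256(n-1)^3A_{n-2},$$ and $A_n=\sum_{k=0}^n\binom{2k}{k}^2\binom{2n-2k}{n-k}^2$ is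 exactly the sequence OEIS A036917.
   Context: The differential component of a row basis $B$ is the matrix $M_\theta$ of rational functions with $\theta(B)=B\,M_\theta$, where $\theta$ acts entrywise. ''Away from the rank-drop locus'' means that the three entries of $B_{\mathrm{sym}}$, respectively of $B_g$, form a basis of the rank-$3$ D-finite module generated by $g$ over the field of rational functions in $z$ and the parameters. In general the basis-change matrix $\Phi$, with $B_{\mathrm{sym}}\Phi=B_g$, is $$\Phi=\begin{pmatrix}1&0&\frac{2abz}{1-z}\\0&2&\frac{2((a+b)z-c+1)}{1-z}\\0&0&2\end{pmatrix}.$$ In operator expressions, $z$ and $z^2$ act by multiplication, so that e.g. $\theta z=z(\theta+1)$. *)

(* Defs.v *)
From HB Require Import structures.
From mathcomp Require Import all_boot all_order all_algebra.
From mathcomp Require Import boolp ring.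

Set Implicit Arguments.
Unset Strict Implicit.
Unset Printing Implicit Defensive.

Import GRing.Theory.
Local Open Scope ring_scope.
Local Open Scope quotient_scope.

(* Formal power series over K, with the Cauchy product. The record keeps the
   pointwise ring structure of nat -> K out of the way. *)
Record series (K : Type) := Series { scoef : nat -> K }.

HB.instance Definition _ (K : Type) := gen_eqMixin (series K).
HB.instance Definition _ (K : Type) := gen_choiceMixin (series K).

Lemma seriesP (K : Type) (s t : series K) : scoef s =1 scoef t -> s = t.
Proof. by case: s => s; case: t => t /= e; congr Series; apply: funext. Qed.

Section SeriesRing.
Variable K : fieldType.
Implicit Types s t u : series K.

Definition sadd s t := Series (fun n => scoef s n + scoef t n).
Definition sopp s := Series (fun n => - scoef s n).
Definition szero : series K := Series (fun=> 0).
Definition sone : series K := Series (fun n => (n == 0)%:R).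
Definition smul s t :=
  Series (fun n => \sum_(i < n.+1) scoef s i * scoef t (n - i)).

Fact saddA : associative sadd.
Proof. by move=> s t u; apply: seriesP => n /=; rewrite addrA. Qed.
Fact saddC : commutative sadd.
Proof. by move=> s t; apply: seriesP => n /=; rewrite addrC. Qed.
Fact sadd0 : left_id szero sadd.
Proof. by move=> s; apply: seriesP => n /=; rewrite add0r. Qed.
Fact saddN : left_inverse szero sopp sadd.
Proof. by move=> s; apply: seriesP => n /=; rewrite addNr. Qed.

HB.instance Definition _ :=
  GRing.isZmodule.Build (series K) saddA saddC sadd0 saddN.

Definition strunc n s : {poly K} := \poly_(i < n) scoef s i.

Lemma smul_strunc N s t n :
  (n < N)%N -> scoef (smul s t) n = (strunc N s * strunc N t)`_n.
Proof.
move=> nN; rewrite coefM /=; apply: eq_bigr => i _; rewrite !coef_poly.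
by rewrite (leq_ltn_trans (leq_subr i n) nN) (leq_ltn_trans (leq_ord i) nN).
Qed.

Fact smulA : associative smul.
Proof.
move=> s t u; apply: seriesP => n.
transitivity ((strunc n.+1 s * (strunc n.+1 t * strunc n.+1 u))`_n).
  rewrite coefM; apply: eq_bigr => i _; rewrite coef_poly ltn_ord.
  by rewrite (@smul_strunc n.+1) // ltnS leq_subr.
rewrite mulrA coefM; apply: eq_bigr => i _.
by rewrite (@smul_strunc n.+1) // [X in _ * X]coef_poly ltnS leq_subr.
Qed.
Fact smulC : commutative smul.
Proof.
by move=> s t; apply: seriesP => n; rewrite !(@smul_strunc n.+1) // mulrC.
Qed.
Fact smul1 : left_id sone smul.
Proof.
move=> s; apply: seriesP => n /=.
by rewrite big_ord_recl /= mul1r subn0 big1 ?addr0 // => i _; rewrite mul0r.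
Qed.
Fact smulDl : left_distributive smul sadd.
Proof.
move=> s t u; apply: seriesP => n /=; rewrite -big_split /=.
by apply: eq_bigr => i _; rewrite mulrDl.
Qed.
Fact sone_neq0 : sone != 0 :> series K.
Proof. by apply/eqP => -[] /(congr1 (@^~ 0)) /eqP /=; rewrite oner_eq0. Qed.

HB.instance Definition _ := GRing.Zmodule_isComNzRing.Build (series K)
  smulA smulC smul1 smulDl sone_neq0.

Definition sunit : pred (series K) := fun s => `[< exists t, t * s = 1 >].
Definition sinv s : series K :=
  if pselect (exists t, t * s = 1) is left ex then projT1 (cid ex) else s.

Fact smulV : {in sunit, left_inverse 1 sinv *%R}.
Proof.
move=> s /asboolP ex; rewrite /sinv; case: pselect => // {}ex.
by case: (cid ex).
Qed.
Fact sunitP s t : t * s = 1 -> sunit s.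
Proof. by move=> ts1; apply/asboolP; exists t. Qed.
Fact sinv_out : {in [predC sunit], sinv =1 id}.
Proof.
move=> s ns; rewrite /sinv; case: pselect => // ex.
by case/negP: ns; apply/asboolP.
Qed.

HB.instance Definition _ :=
  GRing.ComNzRing_hasMulInverse.Build (series K) smulV sunitP sinv_out.

Lemma series_neq0 s : s != 0 ->
  exists2 m, scoef s m != 0 & forall i, (i < m)%N -> scoef s i = 0.
Proof.
move=> s0.
have ex : exists m, scoef s m != 0.
  apply: contrapT => nex; case/eqP: s0; apply: seriesP => n /=.
  by apply/eqP; apply: contrapT => /negP sn; apply: nex; exists n.
exists (ex_minn ex); first by case: ex_minnP.
case: ex_minnP => m _ min i im; apply/eqP; apply: contraTT im => si.
by rewrite -leqNgt min.
Qed.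

Fact series_integral (s t : series K) : s * t = 0 -> (s == 0) || (t == 0).
Proof.
move=> st0; apply: contraPT isT => /norP[/series_neq0[m sm smin]].
move=> /series_neq0[n tn tmin] _.
have /eqP := congr1 (fun u => scoef u (m + n)) st0.
rewrite /= (bigD1 (Ordinal (leq_addr n m : m < (m + n).+1)%N)) //= addKn.
rewrite big1 ?addr0 ?mulf_eq0 ?(negPf sm) ?(negPf tn) // => i /eqP im.
have [lt_im|] := ltnP i m; first by rewrite smin ?mul0r.
rewrite leq_eqVlt => /predU1P[mi|lt_mi]; first by case: im; apply: val_inj.
by rewrite tmin ?mulr0 // ltn_subLR ?ltn_add2r // -ltnS.
Qed.

HB.instance Definition _ :=
  GRing.ComUnitRing_isIntegral.Build (series K) series_integral.

(* theta = z d/dz *)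
Definition stheta s : series K := Series (fun n => n%:R * scoef s n).

Definition series_of_poly (p : {poly K}) : series K := Series (fun n => p`_n).

End SeriesRing.

(* K((z)) is the fraction field of K[[z]]. The parameters live in K, so that
   ratfun K = K(z) is the field of rational functions in z and the parameters
   (take K = Q(a,b,c) for indeterminate parameters). *)
Notation laurent K := {fraction (series K)}.
Notation ratfun K := {fraction {poly K}}.
Notation "x %:F" := (FracField.tofrac x) : ring_scope.

Section Laurent.
Variable K : fieldType.

Definition of_ratfun (r : ratfun K) : laurent K :=
  (series_of_poly \n_(repr r))%:F / (series_of_poly \d_(repr r))%:F.

(* Extension of stheta by the quotient rule *)
Definition theta (x : laurent K) : laurent K :=
  let n := \n_(repr x) in let d := \d_(repr x) in
  (stheta n * d - n * stheta d)%:F / (d ^+ 2)%:F.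

Fact sop_zmod_morphism : zmod_morphism (@series_of_poly K).
Proof. by move=> p q; apply: seriesP => n /=; rewrite coefB. Qed.
Fact sop_monoid_morphism : monoid_morphism (@series_of_poly K).
Proof.
split; first by apply: seriesP => n /=; rewrite coef1.
by move=> p q; apply: seriesP => n /=; rewrite coefM.
Qed.
HB.instance Definition _ := GRing.isZmodMorphism.Build {poly K} (series K)
  (@series_of_poly K) sop_zmod_morphism.
HB.instance Definition _ := GRing.isMonoidMorphism.Build {poly K} (series K)
  (@series_of_poly K) sop_monoid_morphism.

Lemma series_of_poly_eq0 (p : {poly K}) : (series_of_poly p == 0) = (p == 0).
Proof.
apply/eqP/eqP => [p0|->]; last exact: rmorph0.
by apply/polyP => n; rewrite coef0 -[LHS]/(scoef (series_of_poly p) n) p0.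
Qed.

Lemma frac_repr (R : idomainType) (x : {fraction R}) :
  x = (\n_(repr x))%:F / (\d_(repr x))%:F.
Proof.
have d0 : (\d_(repr x))%:F != 0 :> {fraction R}.
  by rewrite tofrac_eq0 denom_ratioP.
apply: (mulIf d0); rewrite divfK // -{1}[x]reprK.
have -> : (\d_(repr x))%:F = \pi_({fraction R}) (Ratio \d_(repr x) 1).
  by unlock FracField.tofrac.
have -> : (\n_(repr x))%:F = \pi_({fraction R}) (Ratio \n_(repr x) 1).
  by unlock FracField.tofrac.
rewrite -[LHS]FracField.pi_mul; apply/eqmodP => /=; rewrite FracField.equivfE.
rewrite /FracField.mulf !numden_Ratio ?oner_eq0 ?mulf_neq0 ?oner_eq0 //.
  by rewrite !mulr1 mulrC.
- exact: denom_ratioP.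
- exact: denom_ratioP.
Qed.

Lemma of_ratfunE (p q : {poly K}) : q != 0 ->
  of_ratfun (p%:F / q%:F) = (series_of_poly p)%:F / (series_of_poly q)%:F.
Proof.
move=> q0; rewrite /of_ratfun; set r := p%:F / q%:F.
have /eqP := frac_repr r; rewrite {1}/r.
have d0 := denom_ratioP (repr r).
rewrite eqr_div ?tofrac_eq0 // -!tofracM tofrac_eq => /eqP e.
apply/eqP; rewrite eqr_div ?tofrac_eq0 ?series_of_poly_eq0 // -!tofracM.
by rewrite tofrac_eq -!rmorphM e mulrC.
Qed.

Fact of_ratfun_zmod_morphism : zmod_morphism of_ratfun.
Proof.
move=> x y; rewrite [x]frac_repr [y]frac_repr.
move: (denom_ratioP (repr x)) (denom_ratioP (repr y)).
move: \n_(repr x) \d_(repr x) \n_(repr y) \d_(repr y) => p q r t q0 t0.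
rewrite -mulNr addf_div ?tofrac_eq0 // -tofracN -!tofracM -tofracD.
rewrite !of_ratfunE ?mulf_neq0 // -mulNr addf_div ?tofrac_eq0 ?series_of_poly_eq0 //.
by rewrite -tofracN -!tofracM -tofracD !(rmorphD, rmorphM, rmorphN).
Qed.
Fact of_ratfun_monoid_morphism : monoid_morphism of_ratfun.
Proof.
split=> [|x y].
  by rewrite -[X in of_ratfun X]divr1 -tofrac1 of_ratfunE ?oner_eq0 // rmorph1
             tofrac1 divr1.
rewrite [x]frac_repr [y]frac_repr.
move: (denom_ratioP (repr x)) (denom_ratioP (repr y)).
move: \n_(repr x) \d_(repr x) \n_(repr y) \d_(repr y) => p q r t q0 t0.
rewrite mulf_div -!tofracM !of_ratfunE ?mulf_neq0 //.
by rewrite mulf_div -!tofracM !rmorphM.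
Qed.
HB.instance Definition _ := GRing.isZmodMorphism.Build (ratfun K) (laurent K)
  of_ratfun of_ratfun_zmod_morphism.
HB.instance Definition _ := GRing.isMonoidMorphism.Build (ratfun K) (laurent K)
  of_ratfun of_ratfun_monoid_morphism.

Lemma stheta_mul (s t : series K) :
  stheta (s * t) = stheta s * t + s * stheta t.
Proof.
apply: seriesP => n /=; rewrite mulr_sumr -big_split /=; apply: eq_bigr => i _.
rewrite [scoef s i * (_ * _)]mulrCA -mulrA -mulrDl -natrD subnKC //.
exact: leq_ord.
Qed.

Lemma thetaE (s t : series K) : t != 0 ->
  theta (s%:F / t%:F) = (stheta s * t - s * stheta t)%:F / (t ^+ 2)%:F.
Proof.
move=> t0; rewrite /theta /=; set x := s%:F / t%:F.
have /eqP := frac_repr x; rewrite {1}/x.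
have := denom_ratioP (repr x).
move: \n_(repr x) \d_(repr x) => n d d0.
rewrite eqr_div ?tofrac_eq0 // -!tofracM tofrac_eq => /eqP e.
apply/eqP; rewrite eqr_div ?tofrac_eq0 ?expf_neq0 // -!tofracM tofrac_eq.
have := congr1 (@stheta K) e; rewrite !stheta_mul => e'.
apply/eqP.
have -> : (stheta n * d - n * stheta d) * t ^+ 2 =
    (stheta n * t + n * stheta t) * (d * t) - n * t * (stheta d * t + d * stheta t).
  by ring.
by rewrite -e' -e; ring.
Qed.

(* In K(z): the variable and the constants *)
Definition zz : ratfun K := 'X%:F.
Definition cst (x : K) : ratfun K := x%:P%:F.

Definition zL : laurent K := of_ratfun zz.

(* The operator p(theta), for p with constant coefficients; products of such
   polynomials are compositions of operators. *)
Definition theta_poly (p : {poly K}) (h : laurent K) : laurent K :=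
  \sum_(i < size p) of_ratfun (cst p`_i) * iter i theta h.

(* The K(z)<theta>-submodule of K((z)) generated by g *)
Definition dmodule (g h : laurent K) : Prop :=
  exists (n : nat) (r : 'I_n -> ratfun K),
    h = \sum_(i < n) of_ratfun (r i) * iter i theta g.

(* The entries of B are free over K(z) and span V. *)
Definition ratfun_basis (B : 'rV[laurent K]_3) (V : laurent K -> Prop) : Prop :=
  (forall r : 'cV[ratfun K]_3, B *m map_mx of_ratfun r = 0 -> r = 0) /\
  (forall h, V h <-> exists r : 'cV[ratfun K]_3,
                       h = (B *m map_mx of_ratfun r) 0 0).

Definition differential_component (B : 'rV[laurent K]_3)
    (M : 'M[ratfun K]_3) : Prop :=
  map_mx theta B = B *m map_mx of_ratfun M.

Definition basis_change (B B' : 'rV[laurent K]_3) (P : 'M[ratfun K]_3) : Prop :=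
  B *m map_mx of_ratfun P = B'.

Definition row3 (R : nmodType) (x y z : R) : 'rV[R]_3 :=
  \row_(j < 3) [:: x; y; z]`_j.

Definition mx3 (R : nmodType) (x00 x01 x02 x10 x11 x12 x20 x21 x22 : R)
    : 'M[R]_3 :=
  \matrix_(i < 3, j < 3) (nth [::] [:: [:: x00; x01; x02];
                                       [:: x10; x11; x12];
                                       [:: x20; x21; x22]] i)`_j.

Definition poch (x : K) (n : nat) : K := \prod_(i < n) (x + i%:R).

Definition hyp2F1 (a b c : K) : series K :=
  Series (fun n => poch a n * poch b n / (poch c n * n`!%:R)).

Definition gsq (a b c : K) : series K := hyp2F1 a b c ^+ 2.

Definition Bsym (a b c : K) : 'rV[laurent K]_3 :=
  let f := (hyp2F1 a b c)%:F in row3 (f ^+ 2) (f * theta f) (theta f ^+ 2).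

Definition theta_basis (h : laurent K) : 'rV[laurent K]_3 :=
  row3 h (theta h) (theta (theta h)).

Definition Msym (a b c : K) : 'M[ratfun K]_3 :=
  let q := cst (a * b) * zz / (1 - zz) in
  let p := (cst (a + b) * zz - cst c + 1) / (1 - zz) in
  mx3 0       q       0
      2       p       (2 * cst (a * b) * zz / (1 - zz))
      0       1       (2 * (cst (a + b) * zz - cst c + 1) / (1 - zz)).

Definition Mg (a b c : K) : 'M[ratfun K]_3 :=
  mx3
    0 0 (2 * cst (a * b) * zz * (2 * cst c - 1 - 2 * cst (a + b) * zz)
         / (1 - zz) ^+ 2)
    1 0 ((- 2 * cst (a ^+ 2 + 4 * a * b + b ^+ 2) * zz ^+ 2
          + cst (4 * a * b + 4 * a * c + 4 * b * c - 3 * a - 3 * b - c + 1) * zz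
          - 2 * cst (c - 1) ^+ 2) / (1 - zz) ^+ 2)
    0 1 (3 * (cst (a + b) * zz - cst c + 1) / (1 - zz)).

Definition Qpoly (a b c : K) : {poly K} :=
  4 *: 'X^3 + (6 * (a + b + c - 1)) *: 'X^2
  + (2 * (4 * a * b + 4 * a * c + 4 * b * c - 3 * a - 3 * b - c + 1)) *: 'X
  + (4 * a * b * (2 * c - 1))%:P.

Definition Lop (a b c : K) (h : laurent K) : laurent K :=
  theta_poly (2 *: ('X * ('X + (c - 1)%:P) * ('X + (2 * c - 2)%:P))) h
  - zL * theta_poly (Qpoly a b c) h
  + 2 * zL ^+ 2 *
    theta_poly (('X + (a + b)%:P) * ('X + (2 * a)%:P) * ('X + (2 * b)%:P)) h.

Definition Phi_pi : 'M[ratfun K]_3 :=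
  mx3 1 0 (zz / (2 * (1 - zz)))
      0 2 (2 * zz / (1 - zz))
      0 0 2.

Definition Msym_pi : 'M[ratfun K]_3 :=
  mx3 0 (zz / (4 * (1 - zz))) 0
      2 (zz / (1 - zz))       (zz / (2 * (1 - zz)))
      0 1                     (2 * zz / (1 - zz)).

Definition Msq_pi : 'M[ratfun K]_3 :=
  mx3 0 0 (zz * (1 - 2 * zz) / (2 * (1 - zz) ^+ 2))
      1 0 (zz * (2 - 3 * zz) / (1 - zz) ^+ 2)
      0 1 (3 * zz / (1 - zz)).

(* Multiplication by powers of z on the left of the operators in theta *)
Definition Lpi (h : laurent K) : laurent K :=
  theta_poly (2 *: 'X^3) h
  - zL * theta_poly ((2 *: 'X + 1) * (2 *: 'X^2 + 2 *: 'X + 1)) h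
  + 2 * zL ^+ 2 * theta_poly (('X + 1) ^+ 3) h.

(* The operators in theta are applied after multiplication by powers of z *)
Definition Lpi' (h : laurent K) : laurent K :=
  theta_poly (2 *: 'X^3) h
  - theta_poly ((2 *: 'X - 1) * (2 *: 'X^2 - 2 *: 'X + 1)) (zL * h)
  + theta_poly (2 *: ('X - 1) ^+ 3) (zL ^+ 2 * h).

End Laurent.

Arguments zz {K}.
Arguments zL {K}.

(* OEIS A036917, by the closed formula of its entry *)
Definition A036917 (n : nat) : nat :=
  (\sum_(k < n.+1) 'C(2 * k, k) ^ 2 * 'C(2 * n - 2 * k, n - k) ^ 2)%N.

(* Initial terms as listed in the OEIS *)
Lemma A036917_data :
  [seq A036917 n | n <- iota 0 6] = [:: 1; 8; 88; 1088; 14296; 195008]%N.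
Proof.
by rewrite /A036917 /= !big_ord_recr !big_ord0 /= !binE.
Qed.

(* Main.v *)
Require Import Defs.
From HB Require Import structures.
From mathcomp Require Import all_boot all_order all_algebra.
From mathcomp Require Import ring.

Set Implicit Arguments.
Unset Strict Implicit.
Unset Printing Implicit Defensive.

Import GRing.Theory.
Local Open Scope ring_scope.

(** The hypergeometric series f satisfies a second-order equation: the ratio
    of consecutive coefficients is a rational function of the index, and this
    recurrence reads theta (theta + c - 1) f = z (theta + a) (theta + b) f
    ([hyp2F1_theta_poly]). Solved for theta^2 f, it says that the K(z)-span of
    f and theta f is stable under the derivation theta, hence so is the span
    of f^2, f theta f and (theta f)^2. The matrix of theta on these three
    products comes from the Leibniz rule alone, and expressing theta^3 (f^2)
    by f^2 and its first two derivatives is then a computation with rational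
    functions. Both take place in an arbitrary field with a derivation D
    ([differential_sym_mx], [differential_sq_mx]); K((z)) with theta is an
    instance.

    After multiplication by 2 (1 - z)^2, the last column of the companion
    matrix becomes the operator L, for every h and not only for g
    ([Mg_Lop]). The uniqueness of each matrix is the freeness of the basis
    ([free_mulmx_inj]).

    On power series, p(theta) multiplies the n-th coefficient by p(n) and z
    shifts the coefficients, so that L g = 0 is a recurrence, read coefficient
    by coefficient ([Lop_eq0_rec]). For a = b = 1/2 and c = 1 the polynomials
    in L factor as displayed; the form with z on the right of the operators in
    theta comes from theta z = z (theta + 1) ([theta_poly_zLM]). Finally
    4^n (1/2)_n = binom(2n,n) n! turns the coefficients of f into squares of
    central binomial coefficients over 16^n ([scoef_hyp2F1_half]), and the
    Cauchy product of f with itself is the sum that defines A036917. *)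

(** * Preliminaries *)

(** The hypothesis of an identity and its conclusion often have the same
    difference of sides, which [ring] can check. *)
Lemma eq_of_subr (V : zmodType) (x y u v : V) :
  u = v -> x - y = u - v -> x = y.
Proof. by move=> -> /eqP; rewrite subrr subr_eq0 => /eqP. Qed.

Lemma natr_neq0 (K : fieldType) (charK0 : [pchar K] =i pred0) n :
  n.+1%:R != 0 :> K.
Proof. by rewrite ((pcharf0P K).1 charK0). Qed.

Section Rows.
Variables R S : pzRingType.

Lemma row3_inj (x y z x' y' z' : R) :
  row3 x y z = row3 x' y' z' <-> [/\ x = x', y = y' & z = z'].
Proof.
split=> [/rowP e|[-> -> ->] //].
by have := (e 0, e 1, e 2%:R); rewrite !mxE /= => -[[]].
Qed.

Lemma map_row3 (f : R -> S) (x y z : R) :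
  map_mx f (row3 x y z) = row3 (f x) (f y) (f z).
Proof. by apply/rowP => -[[|[|[|//]]] ?]; rewrite !mxE. Qed.

Lemma row3_mulmx_mx3 (f : {rmorphism S -> R}) (x y z : R)
    (m00 m01 m02 m10 m11 m12 m20 m21 m22 : S) :
  row3 x y z *m map_mx f (mx3 m00 m01 m02 m10 m11 m12 m20 m21 m22)
  = row3 (x * f m00 + y * f m10 + z * f m20)
         (x * f m01 + y * f m11 + z * f m21)
         (x * f m02 + y * f m12 + z * f m22).
Proof.
apply/rowP => -[[|[|[|//]]] ?];
by rewrite !mxE !big_ord_recl big_ord0 !mxE /= addr0 addrA.
Qed.

End Rows.

(** * The square of a solution in a differential field *)

(** The operator form is 2 (1 - z)^2 times the companion equation. The h_i
    stand for the successive derivatives of an arbitrary h. *)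
Lemma companion_operatorP (F : fieldType) (a b c z h0 h1 h2 h3 : F) :
  1 - z != 0 -> 2 != 0 :> F ->
  h3 = h0 * (2 * (a * b) * z * (2 * c - 1 - 2 * (a + b) * z) / (1 - z) ^+ 2)
  + h1 *
    ((- 2 * (a ^+ 2 + 4 * a * b + b ^+ 2) * z ^+ 2
      + (4 * a * b + 4 * a * c + 4 * b * c - 3 * a - 3 * b - c + 1) * z
      - 2 * (c - 1) ^+ 2) / (1 - z) ^+ 2)
  + h2 * (3 * ((a + b) * z - c + 1) / (1 - z))
  <->
  2 * (h3 + (3 * c - 3) * h2 + 2 * (c - 1) ^+ 2 * h1)
  - z * (4 * h3 + 6 * (a + b + c - 1) * h2
         + 2 * (4 * a * b + 4 * a * c + 4 * b * c - 3 * a - 3 * b - c + 1) * h1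
         + 4 * a * b * (2 * c - 1) * h0)
  + 2 * z ^+ 2 * (h3 + 3 * (a + b) * h2 + 2 * (a ^+ 2 + 4 * a * b + b ^+ 2) * h1
                  + 4 * (a + b) * a * b * h0) = 0.
Proof.
move=> z1 two.
set m := (X in h3 = X); set L := (X in _ <-> X = 0).
have -> : L = 2 * (1 - z) ^+ 2 * (h3 - m) by rewrite /L /m; field.
split=> [->|/eqP]; first by rewrite subrr mulr0.
by rewrite !mulf_eq0 (negPf two) (negPf z1) subr_eq0 => /eqP.
Qed.

Section DifferentialField.
Variables (F : fieldType) (D : {additive F -> F}).
Hypothesis DM : forall x y, D (x * y) = D x * y + x * D y.
Variables a b c z f : F.
Hypotheses (Da : D a = 0) (Db : D b = 0) (Dc : D c = 0) (Dz : D z = z).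
Hypothesis z_neq1 : 1 - z != 0.
Hypothesis f_ode :
  (1 - z) * D (D f) = ((a + b) * z - c + 1) * D f + a * b * z * f.

Lemma D1 : D 1 = 0.
Proof.
have := DM 1 1; rewrite !mulr1 mul1r => /eqP.
by rewrite addrC -subr_eq subrr eq_sym => /eqP.
Qed.

Lemma D2_f :
  D (D f) = (((a + b) * z - c + 1) * D f + a * b * z * f) / (1 - z).
Proof. by rewrite -f_ode mulrC mulKf. Qed.

Lemma D3_f :
  D (D (D f)) = (((a + b + 1) * z - c + 1) * D (D f)
                 + (a + b + a * b) * z * D f + a * b * z * f) / (1 - z).
Proof.
have e := congr1 D f_ode.
rewrite !(DM, raddfD, raddfN) /= Da Db Dc Dz D1 in e.
apply: (mulfI z_neq1); rewrite [RHS]mulrC divfK //.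
by apply: eq_of_subr e _; ring.
Qed.

(** Each derivative of a product of f and D f contains D (D f) at most
    linearly, and the equation of f removes it. *)
Lemma D_sym_square :
  [/\ D (f ^+ 2) = f ^+ 2 * 0 + f * D f * 2 + D f ^+ 2 * 0,
      D (f * D f) = f ^+ 2 * (a * b * z / (1 - z))
        + f * D f * (((a + b) * z - c + 1) / (1 - z)) + D f ^+ 2 * 1
    & D (D f ^+ 2) = f ^+ 2 * 0 + f * D f * (2 * (a * b) * z / (1 - z))
        + D f ^+ 2 * (2 * ((a + b) * z - c + 1) / (1 - z))].
Proof.
rewrite !expr2 !DM D2_f.
by split; first ring; field.
Qed.

Lemma D_sq : D (f ^+ 2) = 2 * f * D f.
Proof. by rewrite expr2 DM; ring. Qed.

Lemma D2_sq : D (D (f ^+ 2)) =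
  f ^+ 2 * (2 * (a * b) * z / (1 - z))
   + f * D f * (2 * ((a + b) * z - c + 1) / (1 - z)) + D f ^+ 2 * 2.
Proof.
by rewrite expr2 !(DM, raddfD) D2_f /=; field.
Qed.

(** Over the span of f^2, f D f and (D f)^2, which is stable under D, the four
    vectors f^2, ..., D^3 (f^2) have a linear relation; this is its solved
    form. *)
Lemma D3_sq :
  D (D (D (f ^+ 2)))
  = f ^+ 2 * (2 * (a * b) * z * (2 * c - 1 - 2 * (a + b) * z) / (1 - z) ^+ 2)
  + D (f ^+ 2) *
    ((- 2 * (a ^+ 2 + 4 * a * b + b ^+ 2) * z ^+ 2
      + (4 * a * b + 4 * a * c + 4 * b * c - 3 * a - 3 * b - c + 1) * z
      - 2 * (c - 1) ^+ 2) / (1 - z) ^+ 2)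
  + D (D (f ^+ 2)) * (3 * ((a + b) * z - c + 1) / (1 - z)).
Proof.
by rewrite !expr2 !(DM, raddfD) /= D3_f D2_f; field.
Qed.

End DifferentialField.

(** The setting of a derivation with coefficients: K holds the constants, E the
    matrix entries and F the functions on which D acts. *)
Section DifferentialMatrices.
Variables (K E F : fieldType) (kappa : {rmorphism K -> E}).
Variables (phi : {rmorphism E -> F}) (D : {additive F -> F}).
Hypothesis DM : forall x y, D (x * y) = D x * y + x * D y.
Variables (a b c : K) (z : E) (f : F).
Hypothesis Dkappa : forall k, D (phi (kappa k)) = 0.
Hypothesis Dz : D (phi z) = phi z.
Hypothesis z_neq1 : 1 - z != 0.

Let A := phi (kappa a).
Let B := phi (kappa b).
Let C := phi (kappa c).
Let Z := phi z.

Let Z_neq1 : 1 - Z != 0.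
Proof. by rewrite -(rmorph1 phi) -rmorphB fmorph_eq0. Qed.

Definition sym_mx : 'M[E]_3 :=
  let q := kappa (a * b) * z / (1 - z) in
  let p := (kappa (a + b) * z - kappa c + 1) / (1 - z) in
  mx3 0       q       0
      2       p       (2 * kappa (a * b) * z / (1 - z))
      0       1       (2 * (kappa (a + b) * z - kappa c + 1) / (1 - z)).

Definition sq_mx : 'M[E]_3 :=
  mx3
    0 0 (2 * kappa (a * b) * z * (2 * kappa c - 1 - 2 * kappa (a + b) * z)
         / (1 - z) ^+ 2)
    1 0 ((- 2 * kappa (a ^+ 2 + 4 * a * b + b ^+ 2) * z ^+ 2
          + kappa (4 * a * b + 4 * a * c + 4 * b * c - 3 * a - 3 * b - c + 1)
            * z
          - 2 * kappa (c - 1) ^+ 2) / (1 - z) ^+ 2)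
    0 1 (3 * (kappa (a + b) * z - kappa c + 1) / (1 - z)).

Lemma differential_sq_mxP (two : 2 != 0 :> F) (h : F) :
  map_mx D (row3 h (D h) (D (D h)))
    = row3 h (D h) (D (D h)) *m map_mx phi sq_mx
  <->
  2 * (D (D (D h)) + (3 * C - 3) * D (D h) + 2 * (C - 1) ^+ 2 * D h)
  - Z * (4 * D (D (D h)) + 6 * (A + B + C - 1) * D (D h)
         + 2 * (4 * A * B + 4 * A * C + 4 * B * C - 3 * A - 3 * B - C + 1) * D h
         + 4 * A * B * (2 * C - 1) * h)
  + 2 * Z ^+ 2 * (D (D (D h)) + 3 * (A + B) * D (D h)
                  + 2 * (A ^+ 2 + 4 * A * B + B ^+ 2) * D h
                  + 4 * (A + B) * A * B * h) = 0.
Proof.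
(* The first two columns only name D h and D (D h) and hold for every h. *)
have e := companion_operatorP A B C h (D h) (D (D h)) (D (D (D h))) Z_neq1 two.
rewrite map_row3 row3_mulmx_mx3; split.
  case/row3_inj => _ _ e3; apply/e.
  by rewrite {}e3; congr (_ * _ + _ * _ + _ * _); rewrite /A /B /C /Z; field.
move/e => e3; apply/row3_inj; split; [by ring | by ring |].
by rewrite {}e3; congr (_ * _ + _ * _ + _ * _); rewrite /A /B /C /Z; field.
Qed.

Hypothesis f_ode :
  (1 - Z) * D (D f) = ((A + B) * Z - C + 1) * D f + A * B * Z * f.

Lemma differential_sym_mx :
  map_mx D (row3 (f ^+ 2) (f * D f) (D f ^+ 2))
  = row3 (f ^+ 2) (f * D f) (D f ^+ 2) *m map_mx phi sym_mx.
Proof.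
have [e0 e1 e2] := D_sym_square DM Z_neq1 f_ode.
rewrite map_row3 row3_mulmx_mx3; apply/row3_inj.
rewrite {}e0 {}e1 {}e2 /A /B /C /Z.
by split; field.
Qed.

Lemma differential_sq_mx :
  map_mx D (row3 (f ^+ 2) (D (f ^+ 2)) (D (D (f ^+ 2))))
  = row3 (f ^+ 2) (D (f ^+ 2)) (D (D (f ^+ 2))) *m map_mx phi sq_mx.
Proof.
have e := D3_sq DM (Dkappa a) (Dkappa b) (Dkappa c) Dz Z_neq1 f_ode.
rewrite map_row3 row3_mulmx_mx3; apply/row3_inj; split; [by ring | by ring |].
by rewrite {}e; congr (_ * _ + _ * _ + _ * _); rewrite /A /B /C /Z; field.
Qed.

Definition sym_to_sq_mx : 'M[E]_3 :=
  mx3 1 0 (2 * kappa (a * b) * z / (1 - z))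
      0 2 (2 * (kappa (a + b) * z - kappa c + 1) / (1 - z))
      0 0 2.

Lemma mulmx_sym_to_sq :
  row3 (f ^+ 2) (f * D f) (D f ^+ 2) *m map_mx phi sym_to_sq_mx
  = row3 (f ^+ 2) (D (f ^+ 2)) (D (D (f ^+ 2))).
Proof.
have e := D2_sq DM Z_neq1 f_ode.
rewrite row3_mulmx_mx3; apply/row3_inj; split.
- by ring.
- by rewrite (D_sq DM); ring.
by rewrite {}e; congr (_ * _ + _ * _ + _ * _); rewrite /A /B /C /Z; field.
Qed.

End DifferentialMatrices.

Section EllipticSpecialization.
Variables (K E : fieldType) (kappa : {rmorphism K -> E}) (z : E).
Hypotheses (two_neq0 : 2 != 0 :> E) (z_neq1 : 1 - z != 0).

Let four_neq0 : 4 != 0 :> E.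
Proof. by rewrite (natrM _ 2 2) mulf_neq0. Qed.

Lemma sym_mx_half : sym_mx kappa (1 / 2) (1 / 2) 1 z =
  mx3 0 (z / (4 * (1 - z))) 0
      2 (z / (1 - z))       (z / (2 * (1 - z)))
      0 1                   (2 * z / (1 - z)).
Proof.
rewrite /sym_mx; congr mx3; field;
by rewrite ?two_neq0 ?four_neq0 ?z_neq1.
Qed.

Lemma sq_mx_half : sq_mx kappa (1 / 2) (1 / 2) 1 z =
  mx3 0 0 (z * (1 - 2 * z) / (2 * (1 - z) ^+ 2))
      1 0 (z * (2 - 3 * z) / (1 - z) ^+ 2)
      0 1 (3 * z / (1 - z)).
Proof.
rewrite /sq_mx; congr mx3; field;
by rewrite ?two_neq0 ?four_neq0 ?z_neq1.
Qed.

Lemma sym_to_sq_mx_half : sym_to_sq_mx kappa (1 / 2) (1 / 2) 1 z =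
  mx3 1 0 (z / (2 * (1 - z)))
      0 2 (2 * z / (1 - z))
      0 0 2.
Proof.
rewrite /sym_to_sq_mx; congr mx3; field;
by rewrite ?two_neq0 ?four_neq0 ?z_neq1.
Qed.

End EllipticSpecialization.

(** * The derivation theta on Laurent series *)

(** The quotient rule, with primes for derivatives, is additive and satisfies
    the Leibniz rule; these are the two field identities behind it. *)
Lemma quotient_rule_sub (F : fieldType) (n d m e n' d' m' e' : F) :
  d != 0 -> e != 0 ->
  ((n' * e + n * e' - (m' * d + m * d')) * (d * e)
   - (n * e - m * d) * (d' * e + d * e')) / (d * e * (d * e))
  = (n' * d - n * d') / (d * d) - (m' * e - m * e') / (e * e).
Proof. by move=> d0 e0; field; rewrite d0 e0. Qed.

Lemma quotient_rule_mul (F : fieldType) (n d m e n' d' m' e' : F) :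
  d != 0 -> e != 0 ->
  ((n' * m + n * m') * (d * e) - n * m * (d' * e + d * e')) / (d * e * (d * e))
  = (n' * d - n * d') / (d * d) * (m / e)
    + n / d * ((m' * e - m * e') / (e * e)).
Proof. by move=> d0 e0; field; rewrite d0 e0. Qed.

Section Derivation.
Variable K : fieldType.
Implicit Types (s t : series K) (x y h : laurent K) (k : K) (p q : {poly K}).

Fact stheta_zmod_morphism : zmod_morphism (@stheta K).
Proof. by move=> s t; apply: seriesP => n /=; rewrite mulrBr. Qed.
HB.instance Definition _ := GRing.isZmodMorphism.Build (series K) (series K)
  (@stheta K) stheta_zmod_morphism.

Fact theta_zmod_morphism : zmod_morphism (@theta K).
Proof.
move=> x y; rewrite [x]frac_repr [y]frac_repr.
move: (denom_ratioP (repr x)) (denom_ratioP (repr y)).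
move: \n_(repr x) \d_(repr x) \n_(repr y) \d_(repr y) => n d m e d0 e0.
have -> : n%:F / d%:F - m%:F / e%:F = (n * e - m * d)%:F / (d * e)%:F
    :> laurent K.
  by rewrite -mulNr addf_div ?tofrac_eq0 // -tofracN -!tofracM -tofracD mulNr.
rewrite !thetaE ?mulf_neq0 // (raddfB (@stheta K)) /= !stheta_mul.
rewrite !(expr2, tofracD, tofracN, tofracM).
by apply: quotient_rule_sub; rewrite tofrac_eq0.
Qed.
HB.instance Definition _ := GRing.isZmodMorphism.Build (laurent K) (laurent K)
  (@theta K) theta_zmod_morphism.

Lemma thetaM x y : theta (x * y) = theta x * y + x * theta y.
Proof.
rewrite [x]frac_repr [y]frac_repr.
move: (denom_ratioP (repr x)) (denom_ratioP (repr y)).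
move: \n_(repr x) \d_(repr x) \n_(repr y) \d_(repr y) => n d m e d0 e0.
rewrite mulf_div -!tofracM !thetaE ?mulf_neq0 // !stheta_mul.
rewrite !(expr2, tofracD, tofracN, tofracM).
by apply: quotient_rule_mul; rewrite tofrac_eq0.
Qed.

Lemma theta_tofrac s : theta s%:F = (stheta s)%:F.
Proof.
rewrite -[s%:F]divr1 -tofrac1 thetaE ?oner_eq0 //.
have -> : stheta (1 : series K) = 0.
  by apply: seriesP => -[|n] /=; rewrite ?mul0r ?mulr0.
by rewrite mulr1 mulr0 subr0 expr1n tofrac1 divr1.
Qed.

Fact cst_zmod_morphism : zmod_morphism (@cst K).
Proof. by move=> k l; rewrite /cst !rmorphB. Qed.
Fact cst_monoid_morphism : monoid_morphism (@cst K).
Proof. by split=> [|k l]; rewrite /cst ?rmorph1 // !rmorphM. Qed.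
HB.instance Definition _ := GRing.isZmodMorphism.Build K (ratfun K)
  (@cst K) cst_zmod_morphism.
HB.instance Definition _ := GRing.isMonoidMorphism.Build K (ratfun K)
  (@cst K) cst_monoid_morphism.

Lemma of_ratfun_poly p : of_ratfun p%:F = (series_of_poly p)%:F.
Proof.
by rewrite -[p%:F]divr1 -tofrac1 of_ratfunE ?oner_eq0 // rmorph1 tofrac1 divr1.
Qed.

Lemma theta_cst k : theta (of_ratfun (cst k)) = 0.
Proof.
rewrite of_ratfun_poly theta_tofrac -tofrac0; congr (_%:F).
by apply: seriesP => -[|n] /=; rewrite ?mul0r // coefC mulr0.
Qed.

Lemma theta_cstM k h :
  theta (of_ratfun (cst k) * h) = of_ratfun (cst k) * theta h.
Proof. by rewrite thetaM theta_cst mul0r add0r. Qed.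

Lemma theta_zL : theta zL = zL :> laurent K.
Proof.
rewrite /zL of_ratfun_poly theta_tofrac; congr (_%:F).
apply: seriesP => n /=; rewrite coefX.
by case: eqP => [->|_]; rewrite ?mulr0 ?mul1r.
Qed.

Lemma one_sub_zz_neq0 : 1 - zz != 0 :> ratfun K.
Proof.
by rewrite /zz -tofrac1 -tofracB tofrac_eq0 -oppr_eq0 opprB polyXsubC_eq0.
Qed.

Lemma scoef_cstM k s :
  of_ratfun (cst k) * s%:F = (Series (fun n => k * scoef s n))%:F.
Proof.
rewrite of_ratfun_poly -tofracM; congr (_%:F); apply: seriesP => n /=.
rewrite big_ord_recl /= coefC subn0 big1 ?addr0 // => i _.
by rewrite coefC mul0r.
Qed.

Definition sshift s := Series (fun n => if n is n'.+1 then scoef s n' else 0).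

Lemma zL_tofrac s : zL * s%:F = (sshift s)%:F.
Proof.
rewrite /zL of_ratfun_poly -tofracM; congr (_%:F); apply: seriesP => -[|n] /=.
  by rewrite big_ord1 coefX mul0r.
rewrite big_ord_recl big_ord_recl /= !coefX mul0r add0r mul1r subSS subn0.
by rewrite big1 ?addr0 // => i _; rewrite coefX mul0r.
Qed.

Lemma theta_poly_widen n p h : (size p <= n)%N ->
  theta_poly p h = \sum_(i < n) of_ratfun (cst p`_i) * iter i (@theta K) h.
Proof.
move=> le_pn; rewrite /theta_poly.
rewrite (big_ord_widen n (fun i => _ (cst p`_i) * iter i _ h) le_pn) big_mkcond.
apply: eq_bigr => i _; case: ltnP => // le_pi.
by rewrite nth_default // !rmorph0 mul0r.
Qed.

Lemma theta_polyD p q h :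
  theta_poly (p + q) h = theta_poly p h + theta_poly q h.
Proof.
have [np nq] := (leq_maxl (size p) (size q), leq_maxr (size p) (size q)).
rewrite (theta_poly_widen h np) (theta_poly_widen h nq).
rewrite (theta_poly_widen h (size_polyD p q)) -big_split; apply: eq_bigr => i _.
by rewrite coefD !rmorphD mulrDl.
Qed.

Lemma theta_polyC k h : theta_poly k%:P h = of_ratfun (cst k) * h.
Proof.
by rewrite (theta_poly_widen h (size_polyC_leq1 k)) big_ord1 coefC.
Qed.

Lemma theta_polyMX p h : theta_poly (p * 'X) h = theta (theta_poly p h).
Proof.
have sz : (size (p * 'X)%R <= (size p).+1)%N.
  by apply: leq_trans (size_polyMleq _ _) _; rewrite size_polyX addn2.
rewrite (theta_poly_widen h sz) big_ord_recl coefMX /= !rmorph0 mul0r add0r.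
rewrite /theta_poly raddf_sum; apply: eq_bigr => i _ /=.
by rewrite coefMX /= theta_cstM.
Qed.

(** Operators compose as the polynomials multiply because theta commutes with
    constants. *)
Lemma theta_polyM p q h : theta_poly (p * q) h = theta_poly p (theta_poly q h).
Proof.
elim/poly_ind: p => [|p k IHp].
  by rewrite mul0r -polyC0 !theta_polyC !rmorph0 !mul0r.
rewrite mulrDl !theta_polyD mulrAC !theta_polyMX IHp; congr (_ + _).
rewrite theta_polyC; elim/poly_ind: q {IHp} => [|q l IHq].
  by rewrite mulr0 -polyC0 !theta_polyC !rmorph0 !mul0r mulr0.
rewrite mulrDr mulrA !theta_polyD !theta_polyMX IHq -polyCM !theta_polyC.
rewrite theta_cstM.
by rewrite rmorphM rmorphM mulrDr mulrA.
Qed.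

Lemma theta_polyX h : theta_poly 'X h = theta h.
Proof.
by rewrite -['X]mul1r theta_polyMX -polyC1 theta_polyC !rmorph1 mul1r.
Qed.

Lemma theta_polyZ k p h :
  theta_poly (k *: p) h = of_ratfun (cst k) * theta_poly p h.
Proof. by rewrite -mul_polyC theta_polyM theta_polyC. Qed.

Lemma theta_poly_XaddC k h :
  theta_poly ('X + k%:P) h = theta h + of_ratfun (cst k) * h.
Proof. by rewrite theta_polyD theta_polyX theta_polyC. Qed.

Lemma thetaD_cstM k x y :
  theta (x + of_ratfun (cst k) * y) = theta x + of_ratfun (cst k) * theta y.
Proof. by rewrite raddfD /= theta_cstM. Qed.

(** The commutation theta z = z (theta + 1), extended from theta to p(theta). *)
Lemma theta_poly_zLM p h :
  theta_poly p (zL * h) = zL * theta_poly (p \Po ('X + 1)) h.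
Proof.
elim/poly_ind: p => [|p k IHp].
  by rewrite comp_poly0 -polyC0 !theta_polyC !rmorph0 !mul0r mulr0.
rewrite comp_poly_MXaddC [_ * ('X + 1)]mulrDr mulr1 !theta_polyD !theta_polyMX.
rewrite IHp thetaM theta_zL !theta_polyC.
by rewrite 2!mulrDr [_ * (zL * _)]mulrCA [zL * theta _ + _]addrC.
Qed.

(** theta is diagonal on power series, with eigenvalue n on z^n. *)
Lemma theta_poly_tofrac p s :
  theta_poly p s%:F = (Series (fun n => p.[n%:R] * scoef s n))%:F.
Proof.
elim/poly_ind: p => [|p k IHp].
  rewrite -polyC0 theta_polyC !rmorph0 mul0r -tofrac0; congr (_%:F).
  by apply: seriesP => n /=; rewrite horner0 mul0r.
rewrite theta_polyD theta_polyMX IHp theta_tofrac theta_polyC scoef_cstM.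
rewrite -tofracD.
by congr (_%:F); apply: seriesP => n /=; rewrite hornerMXaddC; ring.
Qed.

End Derivation.

(** * The hypergeometric function and its square *)

Section HypODE.
Variables (K : fieldType) (a b c : K).
Hypothesis charK0 : [pchar K] =i pred0.
Hypothesis c_neq_negn : forall n : nat, c + n%:R != 0.

Let f : laurent K := (hyp2F1 a b c)%:F.

Lemma pochS (x : K) n : poch x n.+1 = poch x n * (x + n%:R).
Proof. by rewrite /poch big_ord_recr. Qed.

Lemma poch_neq0 n : poch c n != 0.
Proof. by apply/prodf_neq0. Qed.

Lemma hyp2F1_coef_rec n :
  n.+1%:R * (n%:R + c) * scoef (hyp2F1 a b c) n.+1
  = (n%:R + a) * (n%:R + b) * scoef (hyp2F1 a b c) n.
Proof.
have fact_neq0 : n`!%:R != 0 :> K.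
  by rewrite ((pcharf0P K).1 charK0) -lt0n fact_gt0.
rewrite /= !pochS factS natrM; field.
by rewrite fact_neq0 poch_neq0 nat1r natr_neq0 // c_neq_negn.
Qed.

(** The recurrence of the coefficients, read at the coefficient of z^(n+1);
    the constant coefficient vanishes on both sides. *)
Lemma hyp2F1_theta_poly :
  theta_poly ('X * ('X + (c - 1)%:P)) f
  = zL * theta_poly (('X + a%:P) * ('X + b%:P)) f.
Proof.
rewrite !theta_poly_tofrac zL_tofrac; congr (_%:F); apply: seriesP => -[|n].
  by rewrite /= hornerM hornerX mulr0n !mul0r.
rewrite [LHS]/= [RHS]/= !hornerM !hornerD !hornerC !hornerX -hyp2F1_coef_rec /=.
by rewrite -natr1; ring.
Qed.

Let al : laurent K := of_ratfun (cst a).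
Let be : laurent K := of_ratfun (cst b).
Let ga : laurent K := of_ratfun (cst c).

Lemma hyp2F1_ode :
  (1 - zL) * theta (theta f)
  = ((al + be) * zL - ga + 1) * theta f + al * be * zL * f.
Proof.
have := hyp2F1_theta_poly.
rewrite !theta_polyM !theta_poly_XaddC theta_polyX !thetaD_cstM.
rewrite -/al -/be !(rmorphB, rmorph1) -/ga => e.
by apply: eq_of_subr e _; ring.
Qed.

Lemma Bsym_component : differential_component (Bsym a b c) (Msym a b c).
Proof.
exact: (@differential_sym_mx _ _ _ (@cst K) (@of_ratfun K) (@theta K)
  (@thetaM K) a b c zz f (one_sub_zz_neq0 K) hyp2F1_ode).
Qed.

Lemma gsq_tofrac : (gsq a b c)%:F = f ^+ 2.
Proof. by rewrite /gsq /f rmorphXn. Qed.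

Lemma Bg_component :
  differential_component (theta_basis (gsq a b c)%:F) (Mg a b c).
Proof.
rewrite gsq_tofrac.
exact: (@differential_sq_mx _ _ _ (@cst K) (@of_ratfun K) (@theta K)
  (@thetaM K) a b c zz f (@theta_cst K) (@theta_zL K)
  (one_sub_zz_neq0 K) hyp2F1_ode).
Qed.

Lemma Lop_expand (h : laurent K) : Lop a b c h =
  2 * (theta (theta (theta h)) + (3 * ga - 3) * theta (theta h)
       + 2 * (ga - 1) ^+ 2 * theta h)
  - zL * (4 * theta (theta (theta h))
          + 6 * (al + be + ga - 1) * theta (theta h)
          + 2 * (4 * al * be + 4 * al * ga + 4 * be * ga
                 - 3 * al - 3 * be - ga + 1) * theta h
          + 4 * al * be * (2 * ga - 1) * h)
  + 2 * zL ^+ 2 * (theta (theta (theta h)) + 3 * (al + be) * theta (theta h)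
                   + 2 * (al ^+ 2 + 4 * al * be + be ^+ 2) * theta h
                   + 4 * (al + be) * al * be * h).
Proof.
rewrite /Lop /Qpoly.
have X3 : 'X^3 = 'X * ('X * 'X) :> {poly K} by [].
have X2 : 'X^2 = 'X * 'X :> {poly K} by [].
rewrite X3 X2 !(theta_polyZ, theta_polyM, theta_poly_XaddC, theta_polyD,
  theta_polyX, theta_polyC).
by rewrite !thetaD_cstM; ring.
Qed.

Lemma Mg_Lop (h : laurent K) :
  differential_component (theta_basis h) (Mg a b c) <-> Lop a b c h = 0.
Proof.
have two0 : 2 != 0 :> laurent K.
  rewrite -(rmorph_nat (@of_ratfun K)) -(rmorph_nat (@cst K)) !fmorph_eq0.
  exact: (natr_neq0 charK0 1).
rewrite Lop_expand.
exact: (@differential_sq_mxP _ _ _ (@cst K) (@of_ratfun K) (@theta K)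
  a b c zz (one_sub_zz_neq0 K) two0 h).
Qed.

End HypODE.

(** A matrix over K(z) is determined by its products with a free row, column by
    column. *)
Lemma free_mulmx_inj (K : fieldType) (B : 'rV[laurent K]_3) V
    (M N : 'M[ratfun K]_3) :
  ratfun_basis B V ->
  B *m map_mx (@of_ratfun K) M = B *m map_mx (@of_ratfun K) N -> M = N.
Proof.
move=> [free _] eMN; apply/matrixP => i j.
have : B *m map_mx (@of_ratfun K) (col j (M - N)) = 0.
  by rewrite map_col colE mulmxA map_mxB mulmxBr eMN subrr mul0mx.
by move/free/matrixP/(_ i 0)/eqP; rewrite !mxE subr_eq0 => /eqP.
Qed.

(** * Recurrences for the coefficients *)

(** The equation L s = 0 at the coefficient of z^(n+1): the factor z^2 reaches
    it only for positive n. *)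
Lemma Lop_eq0_rec (K : fieldType) (a b c : K) (s : series K) :
  Lop a b c s%:F = 0 -> forall n,
  2 * n.+1%:R * (n%:R + c) * (n%:R + 2 * c - 1) * scoef s n.+1
  - (Qpoly a b c).[n%:R] * scoef s n
  + 2 * (if n is m.+1 then
     (m%:R + a + b) * (m%:R + 2 * a) * (m%:R + 2 * b) * scoef s m else 0) = 0.
Proof.
have shift2 x :
    2 * zL ^+ 2 * x = of_ratfun (cst 2) * (zL * (zL * x)) :> laurent K.
  by rewrite !rmorph_nat expr2 !mulrA.
rewrite /Lop shift2 !theta_poly_tofrac !zL_tofrac scoef_cstM.
rewrite -tofracB -tofracD => /eqP; rewrite tofrac_eq0 => /eqP e n.
have := congr1 (fun u => scoef u n.+1) e; rewrite /=.
set Q := (Qpoly a b c).[_]; set q := Q * _.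
rewrite !(hornerZ, hornerM, hornerD, hornerX, hornerC) => {}e.
apply: eq_of_subr e _.
case: n @Q @q => [|m] Q q;
by rewrite ?(hornerM, hornerD, hornerX, hornerC); ring.
Qed.

(** * The parameters a = b = 1/2 and c = 1 *)

Section Half.
Variable K : fieldType.
Hypothesis charK0 : [pchar K] =i pred0.

Let h : K := 1 / 2.

Let hh : h + h = 1.
Proof. by rewrite /h; field; apply: (natr_neq0 charK0 1). Qed.

Let h2 : 2 * h = 1.
Proof. by rewrite /h; field; apply: (natr_neq0 charK0 1). Qed.

Lemma Qpoly_half :
  Qpoly h h 1 = (2 *: 'X + 1) * (2 *: 'X^2 + 2 *: 'X + 1).
Proof.
(* Both sides expanded, the coefficients of the left being polynomials in 2h. *)
have -> : Qpoly h h 1 = 4%:P * 'X^3 + 6%:P * 'X^2 + 4%:P * 'X + 1%:P.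
  rewrite /Qpoly -!mul_polyC; congr (_ + _ %:P * _ + _ %:P * _ + _ %:P).
  - by rewrite hh; ring.
  - transitivity (2 * (2 * h) * (2 * h) + 2 * (2 * h) : K); first ring.
    by rewrite h2; ring.
  - transitivity ((2 * h) * (2 * h) : K); first ring.
    by rewrite h2 mulr1.
by rewrite -!mul_polyC !polyC_natr polyC1; ring.
Qed.

Lemma Lop_half (x : laurent K) : Lop h h 1 x = Lpi x.
Proof.
rewrite /Lop /Lpi Qpoly_half; congr (theta_poly _ _ - _ + _ * theta_poly _ _).
  by rewrite subrr mulr1 subrr !polyC0 !addr0 -mulrA -expr2 -exprS.
by rewrite hh h2 polyC1 -expr2 -exprSr.
Qed.

(** Moving z to the left replaces T by T + 1 in the polynomial that follows it,
    twice for z^2. *)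
Lemma Lpi_Lpi' (x : laurent K) : Lpi x = Lpi' x.
Proof.
have e : zL ^+ 2 * x = zL * (zL * x) by rewrite expr2 mulrA.
have shift_zL y : 2 * zL ^+ 2 * y = zL * (zL * (2 * y)) :> laurent K.
  by rewrite (mulrC 2) expr2 !mulrA.
rewrite /Lpi /Lpi' e !theta_poly_zLM shift_zL.
have -> : ((2 *: 'X - 1) * (2 *: 'X^2 - 2 *: 'X + 1)) \Po ('X + 1)
    = (2 *: 'X + 1) * (2 *: 'X^2 + 2 *: 'X + 1) :> {poly K}.
  rewrite !(comp_polyM, comp_polyB, comp_polyD, comp_polyZ, comp_poly_Xn).
  by rewrite comp_polyX rmorph1 -!mul_polyC !polyC_natr; ring.
have -> : ((2 *: ('X - 1) ^+ 3) \Po ('X + 1)) \Po ('X + 1)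
    = 2 *: ('X + 1) ^+ 3 :> {poly K}.
  rewrite !comp_polyZ !rmorphXn /= !(comp_polyB, comp_polyD) !comp_polyX.
  rewrite !rmorph1.
  by rewrite comp_polyD comp_polyX rmorph1 addrK.
by rewrite !theta_polyZ !rmorph_nat.
Qed.

Let one_neq_negn n : 1 + n%:R != 0 :> K.
Proof. by rewrite nat1r natr_neq0. Qed.

Let two_neq0 : 2 != 0 :> ratfun K.
Proof. by rewrite -(rmorph_nat (@cst K)) fmorph_eq0 (natr_neq0 charK0 1). Qed.

Lemma Msym_half : Msym h h 1 = Msym_pi K.
Proof. exact: (sym_mx_half (@cst K) two_neq0 (one_sub_zz_neq0 K)). Qed.

Lemma Mg_half : Mg h h 1 = Msq_pi K.
Proof. exact: (sq_mx_half (@cst K) two_neq0 (one_sub_zz_neq0 K)). Qed.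

Lemma Bsym_to_Bg_half :
  basis_change (Bsym h h 1) (theta_basis (gsq h h 1)%:F) (Phi_pi K).
Proof.
have z_neq1 := one_sub_zz_neq0 K.
rewrite gsq_tofrac -[Phi_pi K](sym_to_sq_mx_half (@cst K) two_neq0 z_neq1).
exact: (mulmx_sym_to_sq (@thetaM K) z_neq1
  (hyp2F1_ode h h charK0 one_neq_negn)).
Qed.

Lemma central_binS n :
  ('C(2 * n.+1, n.+1) * n.+1`! = 2 * (2 * n).+1 * ('C(2 * n, n) * n`!))%N.
Proof.
have central_fact m : ('C(2 * m, m) * (m`! * m`!) = (2 * m)`!)%N.
  by rewrite -(@bin_fact (2 * m) m) ?mul2n -addnn ?leq_addr // addnK.
apply/eqP; rewrite -(eqn_pmul2r (fact_gt0 n.+1)) -mulnA central_fact.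
have -> : (2 * n.+1 = (2 * n).+2)%N by rewrite mulnS.
rewrite !factS -(central_fact n); apply/eqP; ring.
Qed.

Lemma poch_half n : 4 ^+ n * poch h n = ('C(2 * n, n) * n`!)%:R.
Proof.
elim: n => [|n IHn]; first by rewrite /poch big_ord0 expr0 mulr1 bin0.
rewrite pochS exprSr central_binS natrM -IHn natrM -[(2 * n).+1%:R]natr1 natrM.
transitivity (4 ^+ n * poch h n * (2 * (2 * h) + 4 * n%:R)); first ring.
by rewrite h2; ring.
Qed.

Lemma scoef_hyp2F1_half n :
  16 ^+ n * scoef (hyp2F1 h h 1) n = ('C(2 * n, n) ^ 2)%:R.
Proof.
have fact_neq0 : n`!%:R != 0 :> K.
  by rewrite ((pcharf0P K).1 charK0) -lt0n fact_gt0.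
have -> : 16 = 4 * 4 :> K by ring.
have p1 : poch 1 n = n`!%:R :> K.
  elim: n {fact_neq0} => [|n IHn]; first by rewrite /poch big_ord0.
  by rewrite pochS IHn nat1r -natrM mulnC -factS.
(* One factor 4^n for each of the two Pochhammer symbols (1/2)_n. *)
rewrite /= p1 exprMn mulrA mulrACA !poch_half natrM.
by rewrite natrX; field.
Qed.

(** The factor 16^n splits as 16^i 16^(n-i) over the Cauchy product. *)
Lemma scoef_gsq_half n : 16 ^+ n * scoef (gsq h h 1) n = (A036917 n)%:R.
Proof.
rewrite /gsq expr2 /= mulr_sumr /A036917 natr_sum; apply: eq_bigr => i _.
rewrite -[in X in X * _](subnKC (leq_ord i)) exprD mulrACA !scoef_hyp2F1_half.
by rewrite -natrM mulnBr.
Qed.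

End Half.

Theorem theorem4p8 (K : fieldType) (charK0 : [pchar K] =i pred0) :
  (forall a b c : K, (forall n : nat, c + n%:R != 0) ->
    let g : laurent K := (gsq a b c)%:F in
    let gn (n : nat) : K := scoef (gsq a b c) n in
    let BS := Bsym a b c in
    let Bg := theta_basis g in
    (* (a) *)
    [/\ differential_component BS (Msym a b c)
        /\ (ratfun_basis BS (dmodule g) ->
            forall M, differential_component BS M -> M = Msym a b c),
    (* (b) *)
        [/\ differential_component Bg (Mg a b c),
            ratfun_basis Bg (dmodule g) ->
              forall M, differential_component Bg M -> M = Mg a b c,
            Lop a b c g = 0
          & forall h : laurent K,
              differential_component (theta_basis h) (Mg a b c)
              <-> Lop a b c h = 0]
    (* (c) *)
      & forall n : nat, (2 <= n)%N ->
          2 * n%:R * (n%:R + c - 1) * (n%:R + 2 * c - 2) * gn n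
          - (Qpoly a b c).[n%:R - 1] * gn (n - 1)%N
          + 2 * (n%:R + a + b - 2) * (n%:R + 2 * a - 2) * (n%:R + 2 * b - 2)
            * gn (n - 2)%N = 0])
  /\
    (* (d) *)
  (let h : K := 1 / 2 in
   let g : laurent K := (gsq h h 1)%:F in
   let gn (n : nat) : K := scoef (gsq h h 1) n in
   let A (n : nat) : K := 16 ^+ n * gn n in
   let BS := Bsym h h 1 in
   let Bg := theta_basis g in
   [/\ [/\ basis_change BS Bg (Phi_pi K),
           differential_component BS (Msym_pi K),
           differential_component Bg (Msq_pi K),
           ratfun_basis BS (dmodule g) ->
             (forall P, basis_change BS Bg P -> P = Phi_pi K) /\
             (forall M, differential_component BS M -> M = Msym_pi K)
         & ratfun_basis Bg (dmodule g) ->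
             forall M, differential_component Bg M -> M = Msq_pi K],
       [/\ Lpi g = 0, Lpi' g = 0
         & forall x : laurent K, Lpi x = 0 <-> Lpi' x = 0],
       (* for n = 1 the factor (n - 1) ^+ 3 kills the last term *)
       forall n : nat, (1 <= n)%N ->
         2 * n%:R ^+ 3 * gn n
         - (2 * n%:R - 1) * (2 * n%:R ^+ 2 - 2 * n%:R + 1) * gn (n - 1)%N
         + 2 * (n%:R - 1) ^+ 3 * gn (n - 2)%N = 0,
       forall n : nat, (1 <= n)%N ->
         n%:R ^+ 3 * A n
         = 8 * (2 * n%:R - 1) * (2 * n%:R ^+ 2 - 2 * n%:R + 1) * A (n - 1)%N
           - 256 * (n%:R - 1) ^+ 3 * A (n - 2)%N
     & forall n : nat, A n = (A036917 n)%:R]).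
Proof.
have two_neq0 : 2 != 0 :> K by apply: (natr_neq0 charK0 1).
split=> [a b c c_neq_negn g gn BS Bg|h g gn A BS Bg].
  have compS := Bsym_component a b charK0 c_neq_negn.
  have compG := Bg_component a b charK0 c_neq_negn.
  have Lg0 : Lop a b c g = 0 by apply/(Mg_Lop a b c charK0).
  split.
  - split=> // basisS M compM.
    by apply: (free_mulmx_inj basisS); rewrite -compM.
  - split=> //.
      by move=> basisG M compM; apply: (free_mulmx_inj basisG); rewrite -compM.
    by move=> x; apply: Mg_Lop.
  case=> [|[|n]] // _; have := Lop_eq0_rec Lg0 n.+1.
  rewrite !subSS !subn0 -/(gn _) -/(gn n) => e.
  have -> : n.+2%:R - 1 = n.+1%:R :> K by rewrite -[n.+2%:R]natr1 addrK.
  by apply: eq_of_subr e _; rewrite -/(gn _); ring.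
have c_neq_negn n : 1 + n%:R != 0 :> K by rewrite nat1r natr_neq0.
have compS : differential_component BS (Msym_pi K).
  by rewrite -Msym_half //; apply: Bsym_component.
have compG : differential_component Bg (Msq_pi K).
  by rewrite -Mg_half //; apply: Bg_component.
have changeSG : basis_change BS Bg (Phi_pi K) by apply: Bsym_to_Bg_half.
have Lg0 : Lpi g = 0.
  by rewrite -Lop_half //; apply/(Mg_Lop h h 1 charK0)/Bg_component.
have rec n : (1 <= n)%N ->
    2 * n%:R ^+ 3 * gn n
    - (2 * n%:R - 1) * (2 * n%:R ^+ 2 - 2 * n%:R + 1) * gn (n - 1)%N
    + 2 * (n%:R - 1) ^+ 3 * gn (n - 2)%N = 0.
  case: n => [|n] // _; rewrite -Lop_half // in Lg0.
  have := Lop_eq0_rec Lg0 n; rewrite Qpoly_half //.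
  rewrite !(hornerM, hornerD, hornerZ, hornerXn, hornerX, hornerC) => e.
  apply: eq_of_subr e _; rewrite !subSS !subn0 /gn /h.
  by case: n => [|n]; rewrite ?subSS ?subn0; field; rewrite ?two_neq0.
split=> //.
- split=> //.
    move=> basisS; split=> [P changeP|M compM]; apply: (free_mulmx_inj basisS).
      by rewrite [LHS]changeP changeSG.
    by rewrite -compM.
  by move=> basisG M compM; apply: (free_mulmx_inj basisG); rewrite -compM.
- by split=> // [|x]; rewrite -Lpi_Lpi'.
- case=> [|n] // _; have := rec n.+1 isT; rewrite /A !subSS !subn0 => e.
  (* The claim is half of 16^n.+1 times the recurrence of g. *)
  apply: (mulfI two_neq0); apply: eq_of_subr (congr1 ( *%R (16 ^+ n.+1)) e) _.
  by case: n {e} => [|n]; rewrite ?subSS ?subn0 !exprS; ring.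
- exact: scoef_gsq_half.
Qed.
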